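(* For any $\omega\in\Omega$ and any two interval forecasts $I,J\in\mathcal{C}$: if $I\in\mathcal{C}_{\mathrm{C}}(\omega)$ and $J\in\mathcal{C}_{\mathrm{C}}(\omega)$, then $I\cap J\neq\emptyset$ and $I\cap J\in\mathcal{C}_{\mathrm{C}}(\omega)$.
   Context: $\mathbb{N}=\{1,2,\dots\}$, $\mathbb{N}_0=\mathbb{N}\cup\{0\}$. $\mathcal{C}$ is the set of all non-empty closed subintervals of $[0,1]$ (interval forecasts; one-point intervals allowed). For $I\in\mathcal{C}$ and $f\colon\{0,1\}\to\mathbb{R}$, $\overline{E}_I(f)=\max_{p\in I}[pf(1)+(1-p)f(0)]$. $\Omega=\{0,1\}^{\mathbb{N}}$ is the set of outcome sequences and $\Omega^\lozenge=\bigcup_{n\in\mathbb{N}_0}\{0,1\}^n$ the set of situations, with $\square$ the empty sequence. For $\omega\in\Omega$, $\omega^n$ is its initial segment of length $n$. A forecasting system is a map $\gamma\colon\Omega^\lozenge\to\mathcal{C}$. A real process is a map $F\colon\Omega^\lozenge\to\mathbb{R}$, with process difference $\Delta F(s)(x)=F(sx)-F(s)$. A supermartingale for $\gamma$ is a real process $M$ with $\overline{E}_{\gamma(s)}(\Delta M(s))\le 0$ for all $s\in\Omega^\lozenge$; a test supermartingale for $\gamma$ is a non-negative supermartingale $T$ for $\gamma$ with $T(\square)=1$. A real process $F$ is computable if there are rational numbers $r_{s,n}=(-1)^{\sigma(s,n)}a(s,n)/b(s,n)$, with $a,b,\sigma\colon\Omega^\lozenge\times\mathbb{N}_0\to\mathbb{N}_0$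 computable and $b>0$, and a computable function $e\colon\Omega^\lozenge\times\mathbb{N}_0\to\mathbb{N}_0$, such that $n\ge e(s,N)$ implies $|r_{s,n}-F(s)|\le 2^{-N}$ for all $s,n,N$. An outcome sequence $\omega$ is computably random for $\gamma$ if $\sup_{n\in\mathbb{N}}T(\omega^n)<+\infty$ for every computable test supermartingale $T$ for $\gamma$. For $I\in\mathcal{C}$ (not necessarily with computable endpoints), the stationary forecasting system $\gamma_I$ is given by $\gamma_I(s)=I$ for all $s\in\Omega^\lozenge$, and $\mathcal{C}_{\mathrm{C}}(\omega)=\{I\in\mathcal{C}\colon\omega\text{ is computably random for }\gamma_I\}$. *)

(* Defs.v *)
From mathcomp Require Import all_boot all_order all_algebra.
From mathcomp Require Import all_classical all_reals all_analysis.

Set Implicit Arguments.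
Unset Strict Implicit.
Unset Printing Implicit Defensive.

Import Order.TTheory GRing.Theory Num.Theory.

Local Open Scope classical_set_scope.
Local Open Scope ring_scope.

(** * Computable functions *)

Fixpoint prim_rec (k : nat) (f : k.-tuple nat -> nat)
    (g : k.+2.-tuple nat -> nat) (n : nat) (v : k.-tuple nat) : nat :=
  if n is m.+1 then g [tuple of m :: prim_rec f g m v :: v] else f v.

(* The total recursive functions: [rec_mu] only minimises regular functions,
   so that every member of the class is total.  By Kleene's normal form theorem
   these are exactly the total Turing-computable functions. *)
Inductive recursive : forall k : nat, (k.-tuple nat -> nat) -> Prop :=
| rec_zero k : @recursive k (fun=> 0%N)
| rec_succ : @recursive 1 (fun v => (tnth v ord0).+1)
| rec_proj k (i : 'I_k) : @recursive k (fun v => tnth v i)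
| rec_comp k m (g : m.-tuple nat -> nat) (h : 'I_m -> k.-tuple nat -> nat) :
    recursive g -> (forall i, recursive (h i)) ->
    @recursive k (fun v => g [tuple h i v | i < m])
| rec_prim k (f : k.-tuple nat -> nat) (g : k.+2.-tuple nat -> nat) :
    recursive f -> recursive g ->
    @recursive k.+1 (fun v => prim_rec f g (thead v) [tuple of behead v])
| rec_mu k (g : k.+1.-tuple nat -> nat)
    (reg : forall v : k.-tuple nat, exists n, g [tuple of n :: v] == 0%N) :
    recursive g -> @recursive k (fun v => ex_minn (reg v))
| rec_ext k (f g : k.-tuple nat -> nat) : f =1 g -> recursive f -> recursive g.

(** * Outcomes, situations, forecasts *)

(* The outcomes 0 and 1 are [false] and [true].  Sequences are indexed from 0,
   so that [w n] is the (n+1)-st outcome; the situation [sx] is [rcons s x]. *)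
Definition outcome_sequence := nat -> bool.
Definition situation := seq bool.
Definition initial_segment (w : outcome_sequence) (n : nat) : situation :=
  mkseq w n.

(* Bijective binary numeration: [situation_code [::] = 0] and
   [situation_code (rcons s x) = 2 * situation_code s + 1 + x].
   This is a bijection onto [nat]. *)
Definition situation_code (s : situation) : nat :=
  foldl (fun n (x : bool) => n.*2 + x.+1)%N 0%N s.

Definition computable (f : situation -> nat -> nat) : Prop :=
  exists2 g : 2.-tuple nat -> nat,
    recursive g & forall s n, f s n = g [tuple situation_code s; n].

Record interval_forecast (R : realType) := IntervalForecast {
  forecast_set :> set R;
  forecast_setP : exists a b : R,
    [/\ 0 <= a, a <= b, b <= 1 & forecast_set = `[a, b]%classic] }.

(* The set below is the image of a non-empty compact set under a continuous
   map, so its supremum is a maximum. *)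
Definition upper_expectation (R : realType) (I : interval_forecast R)
    (f : bool -> R) : R :=
  sup [set p * f true + (1 - p) * f false | p in (I : set R)].

Definition forecasting_system (R : realType) := situation -> interval_forecast R.

Definition stationary (R : realType) (I : interval_forecast R) :
  forecasting_system R := fun=> I.

(** * Processes and randomness *)

Definition real_process (R : realType) := situation -> R.

Definition process_difference (R : realType) (F : real_process R)
    (s : situation) (x : bool) : R :=
  F (rcons s x) - F s.

Definition supermartingale (R : realType) (gamma : forecasting_system R)
    (M : real_process R) : Prop :=
  forall s, upper_expectation (gamma s) (process_difference M s) <= 0.

Definition test_supermartingale (R : realType) (gamma : forecasting_system R)
    (T : real_process R) : Prop :=
  [/\ supermartingale gamma T, forall s, 0 <= T s & T [::] = 1].

Definition computable_process (R : realType) (F : real_process R) : Prop :=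
  exists a b sigma e : situation -> nat -> nat,
    [/\ [/\ computable a, computable b, computable sigma & computable e],
        forall s n, (0 < b s n)%N
      & forall s n N, (e s N <= n)%N ->
          `| (-1) ^+ sigma s n * (a s n)%:R / (b s n)%:R - F s | <= 2 ^- N].

Definition computably_random (R : realType) (gamma : forecasting_system R)
    (w : outcome_sequence) : Prop :=
  forall T : real_process R,
    test_supermartingale gamma T -> computable_process T ->
    (ereal_sup [set (T (initial_segment w n))%:E | n in [set n | (0 < n)%N]]
       < +oo)%E.

Definition computably_random_forecasts (R : realType) (w : outcome_sequence) :
  set (interval_forecast R) := [set I | computably_random (stationary I) w].

(* Main.v *)
Require Import Defs.
From mathcomp Require Import all_boot all_order all_algebra.
From mathcomp Require Import all_classical all_reals all_analysis.
From mathcomp Require Import zify ring lra.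

(* Only the upper end of a forecast matters to a bet on outcome 1, and only the
   lower end to a bet on outcome 0.  Let [u] be the smaller right endpoint and
   [l] the larger left endpoint of the two forecasts: each of [u] and [l] is an
   endpoint of a forecast for which [w] is random.

   If [u < l], betting on 1 at a rational price above [u] and on 0 at a larger
   rational price below [l] gives two computable test supermartingales whose
   product grows exponentially along every sequence, so they are not both
   bounded on [w].

   If [l <= u], a computable test supermartingale [T] for [[l, u]] is dominated
   by a positive supermartingale [q] with rational values, obtained by rounding
   [T + 3 * 2 ^- n] with [n] the code of the situation: the added term at least
   halves from a situation to its children, which absorbs the rounding errors.
   No endpoint needs to be computable for this, and whether [q] bets on 1 or on
   0 is decidable.  Up to a constant, [q] is then the product of the
   supermartingale making only its bets on 1 and the one making only its bets
   on 0; both are bounded on [w]. *)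

Set Implicit Arguments.
Unset Strict Implicit.
Unset Printing Implicit Defensive.

Import Order.TTheory GRing.Theory Num.Theory.

Local Open Scope nat_scope.

(** * Closure properties of recursive functions *)

Definition recursive1 (f : nat -> nat) :=
  recursive (fun v : 1.-tuple nat => f (nth 0 v 0)).

Definition recursive2 (f : nat -> nat -> nat) :=
  recursive (fun v : 2.-tuple nat => f (nth 0 v 0) (nth 0 v 1)).

Lemma recursive_nth k i : i < k -> recursive (fun v : k.-tuple nat => nth 0 v i).
Proof.
move=> ik; apply: (rec_ext _ (rec_proj (Ordinal ik))) => v.
by rewrite (tnth_nth 0).
Qed.

Lemma recursive_comp1 k (f : nat -> nat) (h : k.-tuple nat -> nat) :
  recursive1 f -> recursive h -> recursive (fun v => f (h v)).
Proof.
move=> rf rh.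
apply: (rec_ext _ (rec_comp rf (h := fun=> h) (fun=> rh))) => v.
congr f; exact: (nth_mktuple _ _ (ord0 : 'I_1)).
Qed.

Lemma recursive_comp2 k (f : nat -> nat -> nat) (h1 h2 : k.-tuple nat -> nat) :
  recursive2 f -> recursive h1 -> recursive h2 ->
  recursive (fun v => f (h1 v) (h2 v)).
Proof.
move=> rf rh1 rh2.
have rh (i : 'I_2) : recursive (if i == ord0 then h1 else h2).
  by case: (i == ord0).
apply: (rec_ext _ (rec_comp rf rh)) => v.
by congr f; [rewrite (nth_mktuple _ _ (ord0 : 'I_2)) |
  rewrite (nth_mktuple _ _ (ord_max : 'I_2))].
Qed.

Lemma recursive1_tuple (g : 1.-tuple nat -> nat) :
  recursive g -> recursive1 (fun n => g [tuple n]).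
Proof.
by apply: rec_ext => v; congr g; apply: eq_from_tnth => i;
   rewrite ord1 /= [LHS](tnth_nth 0).
Qed.

Lemma recursive2_tuple (g : 2.-tuple nat -> nat) :
  recursive g -> recursive2 (fun m n => g [tuple m; n]).
Proof.
apply: rec_ext => v; congr g; apply: eq_from_tnth => i.
by rewrite !(tnth_nth 0) /=; case: i => [[|[|]]].
Qed.

Lemma recursive_const k n : recursive (fun _ : k.-tuple nat => n).
Proof.
elim: n => [|n IH]; first exact: rec_zero.
exact: (recursive_comp1 (recursive1_tuple rec_succ) IH).
Qed.

Lemma recursive_primrec (f : nat -> nat) (g : nat -> nat -> nat -> nat)
    (r : nat -> nat -> nat) :
  recursive1 f ->
  recursive (fun v : 3.-tuple nat => g (nth 0 v 0) (nth 0 v 1) (nth 0 v 2)) ->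
  (forall x, r 0 x = f x) -> (forall n x, r n.+1 x = g n (r n x) x) ->
  recursive2 r.
Proof.
move=> rf rg r0 rS; apply: (rec_ext _ (rec_prim rf rg)) => v.
rewrite /thead (tnth_nth 0) /=; move: (nth 0 v 0) => n.
have -> : nth 0 v 1 = nth 0 [tuple of behead v] 0 by rewrite /= nth_behead.
by elim: n => [|n IH] /=; rewrite ?r0 // rS IH.
Qed.

Lemma recursive1_primrec (x0 : nat) (g : nat -> nat -> nat) (r : nat -> nat) :
  recursive2 g -> r 0 = x0 -> (forall n, r n.+1 = g n (r n)) -> recursive1 r.
Proof.
move=> rg r0 rS.
(* A dummy second argument reduces this to the binary scheme. *)
have r2 : recursive2 (fun n _ => r n).
  apply: (@recursive_primrec (fun=> x0) (fun m y _ => g m y)) => //.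
    exact: recursive_const.
  by apply: recursive_comp2 => //; apply: recursive_nth.
by apply: (recursive_comp2 r2 (h2 := fun=> 0)); [exact: recursive_nth|exact: rec_zero].
Qed.

Lemma recursive_succ k (f : k.-tuple nat -> nat) :
  recursive f -> recursive (fun v => (f v).+1).
Proof. exact/recursive_comp1/(recursive1_tuple rec_succ). Qed.

Lemma recursive2_addn : recursive2 addn.
Proof.
apply: (@recursive_primrec id (fun _ y _ => y.+1)) => //.
  exact: recursive_nth.
exact/recursive_succ/recursive_nth.
Qed.

Lemma recursive_addn k (f g : k.-tuple nat -> nat) :
  recursive f -> recursive g -> recursive (fun v => f v + g v).
Proof. exact/recursive_comp2/recursive2_addn. Qed.

Lemma recursive2_muln : recursive2 muln.
Proof.
apply: (@recursive_primrec (fun=> 0) (fun _ y x => x + y)) => //.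
  exact: recursive_const.
by apply: recursive_addn; apply: recursive_nth.
Qed.

Lemma recursive_muln k (f g : k.-tuple nat -> nat) :
  recursive f -> recursive g -> recursive (fun v => f v * g v).
Proof. exact/recursive_comp2/recursive2_muln. Qed.

Lemma recursive1_pred : recursive1 predn.
Proof.
by apply: (@recursive1_primrec 0 (fun n _ => n)) => //; apply: recursive_nth.
Qed.

Lemma recursive_subn k (f g : k.-tuple nat -> nat) :
  recursive f -> recursive g -> recursive (fun v => f v - g v).
Proof.
(* The recursion runs on the first argument, so the arguments are swapped: one predecessor is taken
   per unit of the subtrahend. *)
move=> rf rg; apply: (@recursive_comp2 _ (fun m n => n - m)) rg rf.
apply: (@recursive_primrec id (fun _ y _ => y.-1)) => [|||n x].
- exact: recursive_nth.
- by apply: (recursive_comp1 recursive1_pred); apply: recursive_nth.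
- exact: subn0.
- by rewrite subnS.
Qed.

Lemma recursive_nat_of_odd k (f : k.-tuple nat -> nat) :
  recursive f -> recursive (fun v => nat_of_bool (odd (f v))).
Proof.
apply: (@recursive_comp1 _ (fun n => nat_of_bool (odd n))).
apply: (@recursive1_primrec 0 (fun _ y => 1 - y)) => // [|n].
  by apply: recursive_subn; [exact: recursive_const|exact: recursive_nth].
by rewrite /=; case: odd.
Qed.

Lemma recursive_half k (f : k.-tuple nat -> nat) :
  recursive f -> recursive (fun v => (f v)./2).
Proof.
apply: recursive_comp1.
apply: (@recursive1_primrec 0 (fun n y => odd n + y)) => // [|n].
  apply: recursive_addn; last exact: recursive_nth.
  by apply: recursive_nat_of_odd; apply: recursive_nth.
by rewrite /= uphalf_half.
Qed.

Lemma recursive_exp2 k (f : k.-tuple nat -> nat) :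
  recursive f -> recursive (fun v => 2 ^ f v).
Proof.
apply: recursive_comp1.
apply: (@recursive1_primrec 1 (fun _ y => 2 * y)) => // [|n].
  by apply: recursive_muln; [apply: recursive_const|apply: recursive_nth].
by rewrite expnS.
Qed.

Lemma recursive_if_leq k (f g h1 h2 : k.-tuple nat -> nat) :
  recursive f -> recursive g -> recursive h1 -> recursive h2 ->
  recursive (fun v => if f v <= g v then h1 v else h2 v).
Proof.
move=> rf rg r1 r2.
(* With truncated subtraction, [1 - (f v - g v)] is the indicator of [f v <= g v]. *)
have rb : recursive (fun v => 1 - (f v - g v)).
  by do 2?[apply: recursive_subn => //]; apply: recursive_const.
apply: (rec_ext _ (recursive_addn (recursive_muln rb r1)
  (recursive_muln (recursive_subn (recursive_const _ 1) rb) r2))) => v.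
by case: (leqP (f v) (g v)) => fg; lia.
Qed.

Lemma recursive_iter (f : nat -> nat) :
  recursive1 f -> recursive2 (fun n x => iter n f x).
Proof.
move=> rf; apply: (@recursive_primrec id (fun _ y _ => f y)) => //.
  exact: recursive_nth.
by apply: recursive_comp1 => //; apply: recursive_nth.
Qed.

Lemma recursive_prod (f : nat -> nat -> nat) :
  recursive2 f -> recursive2 (fun n x => \prod_(i < n) f i x).
Proof.
move=> rf.
apply: (@recursive_primrec (fun=> 1) (fun n y x => y * f n x)) => [||x|n x].
- exact: recursive_const.
- apply: recursive_muln; first exact: recursive_nth.
  by apply: recursive_comp2 => //; apply: recursive_nth.
- by rewrite big_ord0.
- by rewrite big_ord_recr.
Qed.

(** * Products along the initial segments of a situation *)

(* The situation code of [s] from that of [rcons s x]. *)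
Definition parent (n : nat) : nat := n.-1./2.

Lemma recursive1_parent : recursive1 parent.
Proof.
by apply/recursive_half/(recursive_comp1 recursive1_pred); apply: recursive_nth.
Qed.

Lemma parent_child n (x : bool) : parent (n.*2 + x.+1) = n.
Proof. by rewrite /parent addnS /= addnC half_bit_double. Qed.

(** Each [parent] step lowers a positive code by at least one, so [n] steps from [n] reach the root
    code [0], where [parent] stays. *)
Lemma iter_parent_le k n : iter k parent n <= n - k.
Proof.
elim: k => [|k IH]; first by rewrite subn0.
rewrite iterS /parent; apply: leq_trans (half_leq (leq_pred _)) _.
move: IH; case: (iter k parent n) => [|m]; lia.
Qed.

Lemma situation_code_rcons s x :
  situation_code (rcons s x) = (situation_code s).*2 + x.+1.
Proof. exact: foldl_rcons. Qed.

Lemma situation_code_surj n : exists s, situation_code s = n.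
Proof.
elim/ltn_ind: n => -[|n] IH; first by exists [::].
have [|s es] := IH n./2; first by lia.
(* [n.+1] equals [2 * n./2 + 1 + odd n], so its last outcome is [odd n] and its parent is [n./2]. *)
exists (rcons s (odd n)); rewrite situation_code_rcons es addnS.
by rewrite addnC odd_double_half.
Qed.

Local Open Scope classical_set_scope.
Local Open Scope ring_scope.

(* The code [n] bounds the depth of the situation with code [n], so this is the
   product of [F] over all the nonempty initial segments of [s] once [F 0 = 1]:
   the superfluous iterates of [parent] are all [0]. *)
Definition ancestor_prod (R : realType) (F : nat -> R) (s : situation) : R :=
  \prod_(i < situation_code s) F (iter i parent (situation_code s)).

Lemma ancestor_prod_rcons (R : realType) (F : nat -> R) s x : F 0%N = 1 ->
  ancestor_prod F (rcons s x) =
  ancestor_prod F s * F (situation_code (rcons s x)).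
Proof.
move=> F0; rewrite /ancestor_prod situation_code_rcons.
set c := situation_code s.
have trunc k : \prod_(i < c + k) F (iter i parent c) =
               \prod_(i < c) F (iter i parent c).
  elim: k => [|k IH]; first by rewrite addn0.
  rewrite addnS big_ord_recr /= IH.
  have -> : iter (c + k) parent c = 0%N.
    by apply/eqP; rewrite -leqn0 (leq_trans (iter_parent_le _ _)) //; lia.
  by rewrite F0 mulr1.
(* The child has code [2c + x + 1]: apart from its own factor, its product runs over [2c + x]
   iterates starting at [c], so the product for [s] is padded with [c + x] factors equal to 1. *)
rewrite -(trunc (c + x)%N) addnA addnn.
have := parent_child c x; rewrite addnS => pc.
rewrite big_ord_recl /= mulrC; congr (_ * _); apply: eq_bigr => i _.
by rewrite -[in LHS]iterS iterSr pc.
Qed.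

Lemma ancestor_prod_nil (R : realType) (F : nat -> R) : ancestor_prod F [::] = 1.
Proof. exact: big_ord0. Qed.

Lemma ancestor_prod_ge0 (R : realType) (F : nat -> R) s :
  (forall n, 0 <= F n) -> 0 <= ancestor_prod F s.
Proof. by move=> F0; apply: prodr_ge0. Qed.

(** * Rational product supermartingales along a random sequence *)

Lemma upper_expectation_le (R : realType) (I : interval_forecast R)
    (f : bool -> R) x :
  (forall p, (I : set R) p -> p * f true + (1 - p) * f false <= x) ->
  upper_expectation I f <= x.
Proof.
move=> le_x; apply: ge_sup; last by move=> _ [p Ip <-]; exact: le_x.
have [a [b [_ ab _ EI]]] := forecast_setP I.
exists (a * f true + (1 - a) * f false), a => //.
by rewrite EI /= in_itv /= lexx.
Qed.

Lemma le_upper_expectation (R : realType) (I : interval_forecast R)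
    (f : bool -> R) p :
  (I : set R) p -> p * f true + (1 - p) * f false <= upper_expectation I f.
Proof.
move=> Ip; apply: ub_le_sup; last by exists p.
exists (`|f true| + `|f false|) => _ [r Ir <-].
have [a [b [a0 _ b1 EI]]] := forecast_setP I.
move: Ir; rewrite EI /= in_itv /= => /andP[ar rb].
have := ler_norm (f true); have := ler_norm (f false).
have := normr_ge0 (f true); have := normr_ge0 (f false).
by nra.
Qed.

Lemma recursive_ancestor_prod (a : nat -> nat) : recursive1 a ->
  recursive1 (fun n => \prod_(i < n) a (iter i parent n))%N.
Proof.
move=> ra.
have r : recursive2 (fun i n => a (iter i parent n)).
  apply: (recursive_comp1 ra).
  by apply: (recursive_comp2 (recursive_iter recursive1_parent));
     apply: recursive_nth.
by apply: (recursive_comp2 (recursive_prod r)); apply: recursive_nth.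
Qed.

Lemma computable_code (a : nat -> nat) :
  recursive1 a -> computable (fun s _ => a (situation_code s)).
Proof.
move=> ra; exists (fun v => a (nth 0%N v 0)) => //.
by apply: (recursive_comp1 ra); apply: recursive_nth.
Qed.

(* In terms of codes, the children of [n] are [n.*2.+1] (outcome 0) and
   [n.*2.+2] (outcome 1). *)
Lemma ancestor_prod_bounded (R : realType) (w : outcome_sequence)
    (I : interval_forecast R) (a b : nat -> nat) :
  let F n : R := (a n)%:R / (b n)%:R in
  computably_random (stationary I) w ->
  recursive1 a -> recursive1 b -> (forall n, 0 < b n)%N -> a 0%N = b 0%N ->
  (forall n p, (I : set R) p -> p * F n.*2.+2 + (1 - p) * F n.*2.+1 <= 1) ->
  exists C, forall n, (0 < n)%N -> ancestor_prod F (initial_segment w n) <= C.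
Proof.
move=> F Iw ra rb b0 ab0 superF.
have F0 : F 0%N = 1 by rewrite /F ab0 divff// pnatr_eq0 -lt0n.
have Fge0 s : 0 <= ancestor_prod F s.
  by apply: ancestor_prod_ge0 => n; rewrite divr_ge0.
have testF : test_supermartingale (stationary I) (ancestor_prod F).
  split => // [s|]; last exact: ancestor_prod_nil.
  apply: upper_expectation_le => p Ip; rewrite /process_difference.
  rewrite !ancestor_prod_rcons // !situation_code_rcons addn2 addn1.
  have := superF (situation_code s) p Ip; have := Fge0 s.
  move: (ancestor_prod F s) (F _) (F _) => P x y; nra.
have compF : computable_process (ancestor_prod F).
  (* The values are exact quotients of two integer products, so the approximations are constant in
     [n] and the modulus can be [0]. *)
  pose P (f : nat -> nat) n := (\prod_(i < n) f (iter i parent n))%N.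
  exists (fun s _ => P a (situation_code s)), (fun s _ => P b (situation_code s)).
  exists (fun _ _ => 0%N), (fun _ _ => 0%N); split.
  - split.
    + exact: (computable_code (recursive_ancestor_prod ra)).
    + exact: (computable_code (recursive_ancestor_prod rb)).
    + exact: (@computable_code (fun=> 0%N) (recursive_const 1 0)).
    + exact: (@computable_code (fun=> 0%N) (recursive_const 1 0)).
  - by move=> s n; rewrite prodn_gt0.
  - move=> s n N _; rewrite expr0 mul1r !natr_prod -prodf_div subrr normr0.
    by rewrite invr_ge0 exprn_ge0.
have {testF compF} := Iw _ testF compF.
set S := [set _ | _ in _] => supS.
have leS n : (0 < n)%N ->
    ((ancestor_prod F (initial_segment w n))%:E <= ereal_sup S)%E.
  by move=> n0; apply: (@ereal_sup_ubound _ S); exists n.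
(* The supremum is not minus infinity, since it is at least the real value at time 1. *)
move: supS leS; case: (ereal_sup S) => [r _ leS|//|_ leS].
  by exists r => n /leS; rewrite lee_fin.
by have := leS 1%N isT.
Qed.

Lemma ancestor_prodM (R : realType) (F G : nat -> R) s :
  ancestor_prod F s * ancestor_prod G s = ancestor_prod (fun n => F n * G n) s.
Proof. by rewrite /ancestor_prod big_split. Qed.

Lemma initial_segmentS w n :
  initial_segment w n.+1 = rcons (initial_segment w n) (w n).
Proof. exact: mkseqS. Qed.

(** * Combining a bound from above with a bound from below *)

(** Put [D = 2 * k^2]. The two bets add up to the sure gain [1 / D], whatever [x] is. Their product
    costs at most [k^2 / D^2 = 1 / (2 * D)], which is half of that gain. *)
Lemma opposite_bets_gain (R : realFieldType) (k m : R) (x : bool) :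
  0 < k -> 0 <= m -> m + 1 <= k ->
  1 + (2 * (2 * (k * k)))^-1 <=
  (1 + (x%:R * k - m) / (2 * (k * k))) * (1 + (m + 1 - x%:R * k) / (2 * (k * k))).
Proof.
move=> k0 m0 mk; rewrite -subr_ge0; case: x; rewrite ?mul1r ?mul0r.
  rewrite [leRHS](_ : _ =
    (k * k - (k - m) * (k - m - 1)) / (2 * (k * k)) ^+ 2);
    last by field; rewrite lt0r_neq0.
  by rewrite divr_ge0 ?exprn_even_ge0 //; nra.
rewrite [leRHS](_ : _ = (k * k - m * (m + 1)) / (2 * (k * k)) ^+ 2);
  last by field; rewrite lt0r_neq0.
by rewrite divr_ge0 ?exprn_even_ge0 //; nra.
Qed.

Lemma random_forecasts_overlap (R : realType) (w : outcome_sequence)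
    (X Y : interval_forecast R) (l u : R) :
  computably_random (stationary X) w -> computably_random (stationary Y) w ->
  (forall p, (X : set R) p -> p <= u) -> (forall p, (Y : set R) p -> l <= p) ->
  0 <= u -> l <= 1 -> l <= u.
Proof.
move=> Xw Yw Xu Yl u0 l1; rewrite leNgt; apply/negP => ul.
(* The mesh [1 / K] is less than half the gap, so two consecutive multiples of it fit between [u]
   and [l]. *)
set K := (Num.truncn (2 / (l - u))).+1.
have Klu : 2 < K%:R * (l - u).
  by rewrite -ltr_pdivrMr ?subr_gt0 // truncnS_gt.
set m := (Num.truncn (u * K%:R)).+1.
have /andP[m_le m_gt] : (m%:R <= u * K%:R + 1) && (u * K%:R < m%:R).
  have /andP[t1 t2] := truncn_itv (mulr_ge0 u0 (ler0n R K)).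
  by rewrite t2 andbT /m -natr1 lerD2r.
have K0 : 0 < K%:R :> R by rewrite ltr0n.
have mK : (m < K)%N by rewrite -(ltr_nat R); nra.
(* The rationals [m / K < (m + 1) / K] lie between [u] and [l]; the stake is
   [1 / (2 K)], giving the factors [1 + (x - m / K) / (2 K)] and
   [1 - (x - (m + 1) / K) / (2 K)], with common denominator [D]. *)
pose D := (2 * (K * K))%N.
have Dm : (m + K < D.+1)%N by rewrite /D; nia.
(* The guard makes the factor 1 at the root code [0]. A child code ends in outcome 1 exactly when it
   is even, which [odd n.+1] tests. As [m + K <= D], neither subtraction truncates at a child
   code. *)
pose a1 n := (if n <= 0 then D else D + odd n.+1 * K - m)%N.
pose a2 n := (if n <= 0 then D else D + m.+1 - odd n.+1 * K)%N.
have DE : D%:R = 2 * (K%:R * K%:R) :> R by rewrite !natrM.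
have D0 : 0 < D%:R :> R by rewrite DE; nra.
have rD : recursive1 (fun=> D) by apply: recursive_const.
have rodd : recursive1 (fun n => odd n.+1 * K)%N.
  apply: recursive_muln; last exact: recursive_const.
  by apply: recursive_nat_of_odd; apply: recursive_succ; apply: recursive_nth.
have ra1 : recursive1 a1.
  apply: recursive_if_leq => //; [exact: recursive_nth|exact: rec_zero|].
  by apply: recursive_subn; [exact: recursive_addn|exact: recursive_const].
have ra2 : recursive1 a2.
  apply: recursive_if_leq => //; [exact: recursive_nth|exact: rec_zero|].
  by apply: recursive_subn => //; apply: recursive_addn => //; exact: recursive_const.
have Dgt0 (n : nat) : (0 < D)%N by rewrite muln_gt0 muln_gt0.
pose F (a : nat -> nat) n : R := (a n)%:R / D%:R.
have F1E n (x : bool) : F a1 (n.*2 + x.+1)%N = 1 + (x%:R * K%:R - m%:R) / D%:R.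
  rewrite /F /a1 addnS /= oddD odd_double /= negbK oddb natrB; last by lia.
  by rewrite natrD natrM -addrA mulrDl divff // lt0r_neq0.
have F2E n (x : bool) :
    F a2 (n.*2 + x.+1)%N = 1 + (m%:R + 1 - x%:R * K%:R) / D%:R.
  rewrite /F /a2 addnS /= oddD odd_double /= negbK oddb natrB; last first.
    by rewrite /D; case: (x); nia.
  by rewrite natrD natrM -natr1 -addrA mulrDl divff // lt0r_neq0.
have [|C1 leC1] := ancestor_prod_bounded Xw ra1 rD Dgt0 erefl.
  move=> n p Xp; rewrite -[leLHS]/(p * F a1 n.*2.+2 + (1 - p) * F a1 n.*2.+1).
  have := F1E n true; have := F1E n false; rewrite /= addn2 addn1 => -> ->.
  rewrite -subr_le0
    (_ : _ - _ = (p * K%:R - m%:R) / D%:R); last by ring.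
  rewrite pmulr_lle0 ?invr_gt0 // subr_le0; apply: le_trans (ltW m_gt).
  by rewrite ler_pM2r // Xu.
have [|C2 leC2] := ancestor_prod_bounded Yw ra2 rD Dgt0 erefl.
  move=> n p Yp; rewrite -[leLHS]/(p * F a2 n.*2.+2 + (1 - p) * F a2 n.*2.+1).
  have := F2E n true; have := F2E n false; rewrite /= addn2 addn1 => -> ->.
  rewrite -subr_le0
    (_ : _ - _ = (m%:R + 1 - p * K%:R) / D%:R); last by ring.
  rewrite pmulr_lle0 ?invr_gt0 // subr_le0.
  have : l * K%:R <= p * K%:R by rewrite ler_pM2r // Yl.
  move: m_le Klu; rewrite mulrBr ![K%:R * _]mulrC; set x := p * _; clear; lra.
pose h : R := (2 * D%:R)^-1.
have h0 : 0 < h by rewrite invr_gt0 mulr_gt0.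
(* Each step multiplies the product by at least [1 + h]; the linear Bernoulli bound already suffices
   to exceed any constant. *)
have grow n : 1 + h *+ n <=
    ancestor_prod (fun n => F a1 n * F a2 n) (initial_segment w n).
  elim: n => [|n IH]; first by rewrite mulr0n addr0 ancestor_prod_nil.
  rewrite initial_segmentS ancestor_prod_rcons; last first.
    by rewrite /F /a1 /a2 /= divff ?mulr1 // lt0r_neq0.
  set s := initial_segment w n in IH *.
  have step : 1 + h <= F a1 (situation_code (rcons s (w n))) *
                       F a2 (situation_code (rcons s (w n))).
    rewrite situation_code_rcons F1E F2E /h DE.
    by apply: opposite_bets_gain; rewrite ?natr1 ?ler_nat.
  have h_ge0 := ltW h0; have hn : 0 <= h *+ n by rewrite mulrn_wge0.
  apply: le_trans (ler_pM _ _ IH step); rewrite ?addr_ge0 //.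
  rewrite mulrSr -subr_ge0 (_ : _ - _ = h *+ n * h); last by ring.
  by rewrite mulr_ge0.
(* A positive time at which [h *+ N] exceeds [C1 * C2]. *)
set N := (Num.truncn ((C1 * C2) / h)).+1.
have := grow N; rewrite -ancestor_prodM leNgt => /negP; apply.
have Fge0 a s : 0 <= ancestor_prod (F a) s.
  by apply: ancestor_prod_ge0 => n; rewrite divr_ge0.
apply: le_lt_trans (ler_pM (Fge0 _ _) (Fge0 _ _) (leC1 N isT) (leC2 N isT)) _.
by rewrite ltr_wpDl // -[h *+ N]mulr_natl -ltr_pdivrMr // truncnS_gt.
Qed.

(** * Splitting a supermartingale into its bets on 1 and on 0 *)

Lemma ler_mix (R : realDomainType) (p r x y : R) : p <= r -> x <= y ->
  p * y + (1 - p) * x <= r * y + (1 - r) * x.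
Proof.
move=> pr xy; rewrite -subr_ge0.
rewrite (_ : _ - _ = (r - p) * (y - x)); last by ring.
by rewrite mulr_ge0 // subr_ge0.
Qed.

Lemma ger_mix (R : realDomainType) (p r x y : R) : r <= p -> y <= x ->
  p * y + (1 - p) * x <= r * y + (1 - r) * x.
Proof.
move=> rp yx; rewrite -subr_ge0.
rewrite (_ : _ - _ = (p - r) * (x - y)); last by ring.
by rewrite mulr_ge0 // subr_ge0.
Qed.

(** Each ratio [q n / q (parent n)] goes to one of two products, according to the outcome bet on at
    the parent; the other product gets the factor 1. For a bet on 1 the mean grows with the weight
    of 1, so the inequality at [u] gives it for all [p <= u]; for a bet on 0, the one at [l] gives
    it for all [p >= l]. *)
Lemma split_supermartingale_bounded (R : realType) (w : outcome_sequence)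
    (X Y : interval_forecast R) (l u : R) (a b : nat -> nat) :
  let q n : R := (a n)%:R / (b n)%:R in
  computably_random (stationary X) w -> computably_random (stationary Y) w ->
  (forall p, (X : set R) p -> p <= u) -> (forall p, (Y : set R) p -> l <= p) ->
  recursive1 a -> recursive1 b -> (forall n, 0 < a n)%N -> (forall n, 0 < b n)%N ->
  (forall n, u * q n.*2.+2 + (1 - u) * q n.*2.+1 <= q n) ->
  (forall n, l * q n.*2.+2 + (1 - l) * q n.*2.+1 <= q n) ->
  exists C, forall n, (0 < n)%N ->
    q (situation_code (initial_segment w n)) <= C.
Proof.
move=> q Xw Yw Xu Yl ra rb a0 b0 qu ql.
have q0 n : 0 < q n by rewrite divr_gt0 ?ltr0n.
(* Whether [q] bets on outcome 1 at [n]. *)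
pose up n := (a n.*2.+1 * b n.*2.+2 <= a n.*2.+2 * b n.*2.+1)%N.
have upE n : up n = (q n.*2.+1 <= q n.*2.+2).
  rewrite /up /q ler_pdivrMr ?ltr0n // mulrAC ler_pdivlMr ?ltr0n //.
  by rewrite -!natrM ler_nat.
pose num n := (a n * b (parent n))%N.
pose den n := (b n * a (parent n))%N.
(* [parent 0] is [0], so the ratio at the root is 1. *)
have num_den0 : num 0%N = den 0%N by rewrite /num /den mulnC.
have den0 n : (0 < den n)%N by rewrite muln_gt0 b0 a0.
have ratioE n : (num n)%:R / (den n)%:R = q n / q (parent n).
  by rewrite /num /den /q !natrM invf_div mulf_div.
have rec1 f : recursive1 f -> recursive1 (fun n => f (parent n)).
  by move=> rf; apply: (recursive_comp1 rf); apply: recursive1_parent.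
have rdbl : recursive1 double.
  apply: (rec_ext (f := fun v => (nth 0 v 0 + nth 0 v 0)%N)) => [v|].
    by rewrite addnn.
  by apply: recursive_addn; apply: recursive_nth.
have rchild f : recursive1 f ->
    recursive1 (fun n => f n.*2.+1) /\ recursive1 (fun n => f n.*2.+2).
  by move=> rf; split; apply: (recursive_comp1 rf); do ?apply: recursive_succ.
have [ra1 ra2] := rchild _ ra; have [rb1 rb2] := rchild _ rb.
have rnum : recursive1 num by apply: recursive_muln; rewrite //; apply: rec1.
have rden : recursive1 den by apply: recursive_muln; rewrite //; apply: rec1.
have rone : recursive1 (fun=> 1%N) by apply: recursive_const.
have rup f g : recursive1 f -> recursive1 g ->
    recursive1 (fun n => if up (parent n) then f n else g n).
  move=> rf rg; apply: recursive_if_leq => //.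
    by apply: (rec1 (fun n => a n.*2.+1 * b n.*2.+2)%N); apply: recursive_muln.
  by apply: (rec1 (fun n => a n.*2.+2 * b n.*2.+1)%N); apply: recursive_muln.
have parent1 n : parent n.*2.+1 = n by have := parent_child n false; rewrite addn1.
have parent2 n : parent n.*2.+2 = n by have := parent_child n true; rewrite addn2.
have [|||C1 leC1] := ancestor_prod_bounded Xw (rup _ _ rnum rone) (rup _ _ rden rone).
- by move=> n; case: ifP.
- by rewrite num_den0.
- move=> n p Xp; cbv beta; rewrite parent1 parent2 upE.
  case: ifP => [q12|_]; last by rewrite divr1 -mulrDl addrC subrK mul1r.
  rewrite !ratioE parent1 parent2 [p * _]mulrA [(1 - p) * _]mulrA -mulrDl.
  rewrite ler_pdivrMr // mul1r.
  apply: le_trans (qu n). exact: ler_mix (Xu p Xp) q12.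
have [|||C2 leC2] := ancestor_prod_bounded Yw (rup _ _ rone rnum) (rup _ _ rone rden).
- by move=> n; case: ifP.
- by rewrite num_den0.
- move=> n p Yp; cbv beta; rewrite parent1 parent2 upE.
  case: ifPn => [_|]; first by rewrite divr1 -mulrDl addrC subrK mul1r.
  rewrite -ltNge => q21.
  rewrite !ratioE parent1 parent2 [p * _]mulrA [(1 - p) * _]mulrA -mulrDl.
  rewrite ler_pdivrMr // mul1r.
  apply: le_trans (ql n); exact: ger_mix (Yl p Yp) (ltW q21).
exists (q 0%N * (C1 * C2)) => n n0.
set F1 := fun n => _ in leC1; set F2 := fun n => _ in leC2.
have F12 m : F1 m * F2 m = q m / q (parent m).
  by rewrite /F1 /F2; case: ifP => _; rewrite divr1 ?mulr1 ?mul1r ratioE.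
(* The ratios telescope along the initial segments of [s]. *)
have qE s : q (situation_code s) =
    q 0%N * ancestor_prod (fun m => F1 m * F2 m) s.
  elim/last_ind: s => [|s x IH]; first by rewrite ancestor_prod_nil mulr1.
  rewrite ancestor_prod_rcons; last by rewrite F12 divff // lt0r_neq0.
  rewrite mulrA -IH F12 situation_code_rcons parent_child mulrC divfK //.
  exact: lt0r_neq0.
rewrite qE -ancestor_prodM ler_pM2l //; apply: ler_pM; rewrite ?leC1 ?leC2 //;
  by apply: ancestor_prod_ge0 => m; rewrite divr_ge0.
Qed.

(** * Rational domination of a computable test supermartingale *)

Lemma computably_random_between (R : realType) (w : outcome_sequence)
    (X Y K : interval_forecast R) (l u : R) :
  computably_random (stationary X) w -> computably_random (stationary Y) w ->
  (forall p, (X : set R) p -> p <= u) -> (forall p, (Y : set R) p -> l <= p) ->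
  (K : set R) u -> (K : set R) l -> computably_random (stationary K) w.
Proof.
move=> Xw Yw Xu Yl Ku Kl T [superT T0 _].
move=> [a [b [sigma [e [[ca cb _ ce] b0 approx]]]]].
case: ca cb ce => ga rga aE [gb rgb bE] [ge rge eE].
(* The situation with code [n] is approximated to within [2 ^- n], so the precision improves with
   the code. *)
pose e' n := ge [tuple n; n]; pose b' n := gb [tuple n; e' n].
pose den n := (b' n * 2 ^ n)%N.
pose num n := (ga [tuple n; e' n] * 2 ^ n + 3 * b' n)%N.
have rid : recursive1 id by apply: recursive_nth.
have rexp : recursive1 (fun n => 2 ^ n)%N by apply: recursive_exp2.
have re' : recursive1 e' by apply: (recursive_comp2 (recursive2_tuple rge)).
have rb' : recursive1 b' by apply: (recursive_comp2 (recursive2_tuple rgb)).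
have rden : recursive1 den by apply: recursive_muln.
have rnum : recursive1 num.
  apply: recursive_addn; apply: recursive_muln => //; last exact: recursive_const.
  by apply: (recursive_comp2 (recursive2_tuple rga)).
have b'0 n : (0 < b' n)%N.
  by have [s <-] := situation_code_surj n; rewrite /b' -bE.
have den0 n : (0 < den n)%N by rewrite /den muln_gt0 b'0 expn_gt0.
have num0 n : (0 < num n)%N by rewrite /num addn_gt0 orbC muln_gt0 b'0.
pose q n : R := (num n)%:R / (den n)%:R.
have qT s : T s + 2 * 2 ^- situation_code s <= q (situation_code s)
                                      <= T s + 4 * 2 ^- situation_code s.
  set n := situation_code s.
  have := approx s (e s n) n (leqnn _); rewrite aE bE eE -/n -/(e' n) -/(b' n).
  (* [T] is nonnegative, so the sign of its approximation can be dropped. *)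
  have -> : q n = `|(-1) ^+ sigma s (e' n) * (ga [tuple n; e' n])%:R / (b' n)%:R|
                  + 3 * 2 ^- n.
    rewrite !normrM normr_sign mul1r normfV !ger0_norm // /q /num /den.
    rewrite natrD !natrM natrX; field.
    by rewrite expf_neq0 //= pnatr_eq0 -lt0n.
  move=> le_r; have := le_trans (ler_dist_dist _ _) le_r.
  rewrite (ger0_norm (T0 s)) ler_norml; move: `|_| (2 ^- n) => r eps.
  by clear; lra.
(* A child code [k] exceeds [n], so its excess over [T], at most [4 * 2 ^- k], is no more than
   [2 * 2 ^- n], the least excess at [n]. The inequality for [T] thus carries over to [q]. *)
have step p n : (K : set R) p -> p * q n.*2.+2 + (1 - p) * q n.*2.+1 <= q n.
  move=> Kp; have [s sn] := situation_code_surj n.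
  have := qT (rcons s true); have := qT (rcons s false); have := qT s.
  rewrite !situation_code_rcons sn addn2 addn1 => /andP[q_ge _] /andP[_ q1] /andP[_ q2].
  have := le_trans (le_upper_expectation (process_difference T s) Kp) (superT s).
  rewrite /process_difference => superTs.
  have half k : (n < k)%N -> 2 * 2 ^- k <= 2 ^- n :> R.
    move=> nk; rewrite -ler_pdivlMl // mulrC -invfM -exprSr.
    by rewrite lef_pV2 ?posrE ?exprn_gt0 // ler_eXn2l // ltr1n.
  have h1 : 2 * 2 ^- n.*2.+1 <= 2 ^- n :> R by apply: half; lia.
  have h2 : 2 * 2 ^- n.*2.+2 <= 2 ^- n :> R by apply: half; lia.
  have [c [d [c0 _ d1 EK]]] := forecast_setP K.
  move: Kp; rewrite EK /= in_itv /= => /andP[cp pd].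
  have p0 : 0 <= p by apply: le_trans cp.
  have p1 : 0 <= 1 - p by rewrite subr_ge0 (le_trans pd).
  have q1' : q n.*2.+1 <= T (rcons s false) + 2 * 2 ^- n.
    by move: q1 h1; clear; lra.
  have q2' : q n.*2.+2 <= T (rcons s true) + 2 * 2 ^- n.
    by move: q2 h2; clear; lra.
  have := ler_wpM2l p0 q2'; have := ler_wpM2l p1 q1'; move: q_ge superTs.
  by clear; lra.
have [||C leC] := split_supermartingale_bounded Xw Yw Xu Yl rnum rden num0 den0.
- by move=> n; apply: step.
- by move=> n; apply: step.
apply: le_lt_trans (ltry C); apply: ge_ereal_sup => _ [n n0 <-].
rewrite lee_fin; apply: le_trans (leC n n0).
have /andP[+ _] := qT (initial_segment w n); apply: le_trans.
by rewrite lerDl mulr_ge0 // invr_ge0 exprn_ge0.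
Qed.

Theorem proposition12 (R : realType) (w : outcome_sequence)
    (I J : interval_forecast R)
    (hI : computably_random_forecasts w I)
    (hJ : computably_random_forecasts w J) :
  (I : set R) `&` (J : set R) !=set0 /\
  exists2 K : interval_forecast R,
    (K : set R) = (I : set R) `&` (J : set R)
    & computably_random_forecasts w K.
Proof.
have [a [b [a0 ab b1 EI]]] := forecast_setP I.
have [c [d [c0 cd d1 EJ]]] := forecast_setP J.
set l := Num.max a c; set u := Num.min b d.
(* [X] is the forecast with the smaller right endpoint; below, [Y] is the one with the larger left
   endpoint. They may coincide. *)
have [X Xw Xu] : exists2 X, computably_random (stationary X) w
    & forall p, (X : set R) p -> p <= u.
  rewrite /u; case: (leP b d) => _; [exists I|exists J] => // p;
  by rewrite ?EI ?EJ /= in_itv /= => /andP[].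
have [Y Yw Yl] : exists2 Y, computably_random (stationary Y) w
    & forall p, (Y : set R) p -> l <= p.
  rewrite /l; case: (leP a c) => _; [exists J|exists I] => // p;
  by rewrite ?EI ?EJ /= in_itv /= => /andP[].
have u0 : 0 <= u by rewrite le_min (le_trans a0) // (le_trans c0).
have l1 : l <= 1 by rewrite ge_max (le_trans ab) // (le_trans cd).
have lu := random_forecasts_overlap Xw Yw Xu Yl u0 l1.
have KP : exists x y : R,
    [/\ 0 <= x, x <= y, y <= 1 & `[l, u]%classic = `[x, y]%classic].
  exists l, u; split => //; first by rewrite le_max a0.
  by rewrite ge_min b1.
pose K := IntervalForecast KP.
have KE : (K : set R) = (I : set R) `&` (J : set R).
  rewrite EI EJ; apply/seteqP; split => x /=; rewrite !in_itv /= ge_max le_min.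
    by case/andP => /andP[-> ->] /andP[-> ->].
  by case=> /andP[-> ->] /andP[-> ->].
have Ku : (K : set R) u by rewrite /= in_itv /= lexx lu.
have Kl : (K : set R) l by rewrite /= in_itv /= lexx lu.
split; first by exists u; rewrite -KE.
exists K => //; exact: computably_random_between Xw Yw Xu Yl Ku Kl.
Qed.
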